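(* Let $-\infty<a<b\le\infty$ and let $f:[a,b)\to\mathbb{R}$ be a convex function. Let $n\ge 1$ and $N\ge 1$ be integers. Let $\mathbf{p}_1=(p_{1,1},\dots,p_{n,1})$ satisfy $p_{i,1}\ge 0$ for $i=1,\dots,n$ and $\sum_{i=1}^n p_{i,1}=1$. For each $k=1,\dots,N$ let $\mathbf{q}_k=(q_{1,k},\dots,q_{n,k})$ be a given $n$-tuple with $q_{i,k}>0$ for $i=1,\dots,n$ and $\sum_{i=1}^n q_{i,k}=1$. Let $\mathbf{x}_1=(x_{1,1},\dots,x_{n,1})\in(a,b)^n$. Let $m_k$ and $\mathbf{x}_k=(x_{1,k},\dots,x_{n,k})$, $k=1,\dots,N$, be the numbers and $n$-tuples obtained from $\mathbf{p}_1,\mathbf{x}_1,\mathbf{q}_1,\dots,\mathbf{q}_N$ by the recursion described in the context. Then $$J_n(f,\mathbf{x}_1,\mathbf{p}_1)-\sum_{k=1}^N m_k\,J_n(f,\mathbf{x}_k,\mathbf{q}_k)\ \ge\ 0 .$$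
   Context: Jensen functional: for a function $f$ on an interval, an $n$-tuple $\mathbf{x}=(x_1,\dots,x_n)$ of points of the interval and a weight $n$-tuple $\mathbf{p}=(p_1,\dots,p_n)$ with $\sum_i p_i=1$, $$J_n(f,\mathbf{x},\mathbf{p})=\sum_{i=1}^n p_i f(x_i)-f\Big(\sum_{i=1}^n p_i x_i\Big).$$ Recursion. The tuples $\mathbf{q}_1,\dots,\mathbf{q}_N$ are given a priori (not constructed). For $k=1,\dots,N$ put $$m_k=\min_{1\le i\le n}\frac{p_{i,k}}{q_{i,k}},$$ and let $s_k$ be the number of indices $i\in\{1,\dots,n\}$ with $p_{i,k}/q_{i,k}=m_k$. For $k=2,\dots,N$ and $i=1,\dots,n$ define $$p_{i,k}=\begin{cases}p_{i,k-1}-m_{k-1}q_{i,k-1}, & \text{if } \dfrac{p_{i,k-1}}{q_{i,k-1}}\ne m_{k-1},\\[2mm] \dfrac{1}{s_{k-1}}\,m_{k-1}, & \text{if } \dfrac{p_{i,k-1}}{q_{i,k-1}}= m_{k-1},\end{cases}$$ $$x_{i,k}=\begin{cases}x_{i,k-1}, & \text{if } \dfrac{p_{i,k-1}}{q_{i,k-1}}\ne m_{k-1},\\[2mm] \sum_{l=1}^n q_{l,k-1}x_{l,k-1}, & \text{if } \dfrac{p_{i,k-1}}{q_{i,k-1}}= m_{k-1}.\end{cases}$$ *)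

(* Defs.v *)
From HB Require Import structures.
From mathcomp Require Import all_boot all_order all_algebra.
From mathcomp Require Import all_classical all_reals ereal convex.

Set Implicit Arguments.
Unset Strict Implicit.
Unset Printing Implicit Defensive.

Import Order.TTheory GRing.Theory Num.Theory.

Local Open Scope classical_set_scope.
Local Open Scope ring_scope.

(* The interval [a, b[ of real numbers; b = +oo is allowed. *)
Definition itv_co_ereal (R : realType) (a : R) (b : \bar R) : set R :=
  [set x | a <= x /\ (x%:E < b)%E].

Definition jensen_functional (R : realType) (n : nat) (f : R -> R)
    (x p : 'I_n -> R) : R :=
  \sum_i p i * f (x i) - f (\sum_i p i * x i).

(* 'I_n.+1 is used from here on so that the minimum is over a nonempty family;
   the seed of the iterated minimum is the ratio at index 0, itself a member
   of the family. *)
Definition min_ratio (R : realType) (n : nat) (p q : 'I_n.+1 -> R) : R :=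
  \big[Num.min/p ord0 / q ord0]_(i < n.+1) (p i / q i).

Definition min_ratio_mult (R : realType) (n : nat) (p q : 'I_n.+1 -> R) : nat :=
  #|[set i : 'I_n.+1 | p i / q i == min_ratio p q]%SET|.

Definition next_p (R : realType) (n : nat) (p q : 'I_n.+1 -> R) :
    'I_n.+1 -> R :=
  fun i => if p i / q i == min_ratio p q
           then (min_ratio_mult p q)%:R^-1 * min_ratio p q
           else p i - min_ratio p q * q i.

Definition next_x (R : realType) (n : nat) (p q x : 'I_n.+1 -> R) :
    'I_n.+1 -> R :=
  fun i => if p i / q i == min_ratio p q then \sum_l q l * x l else x i.

(* Tuples in the sequences below are numbered from 0: q k, p_seq p1 q k,
   x_seq p1 x1 q k and m_seq p1 q k stand for the tuples and the minimum
   usually numbered k + 1. *)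
Fixpoint p_seq (R : realType) (n : nat) (p1 : 'I_n.+1 -> R)
    (q : nat -> 'I_n.+1 -> R) (k : nat) : 'I_n.+1 -> R :=
  if k is k'.+1 then next_p (p_seq p1 q k') (q k') else p1.

Fixpoint x_seq (R : realType) (n : nat) (p1 x1 : 'I_n.+1 -> R)
    (q : nat -> 'I_n.+1 -> R) (k : nat) : 'I_n.+1 -> R :=
  if k is k'.+1 then next_x (p_seq p1 q k') (q k') (x_seq p1 x1 q k') else x1.

Definition m_seq (R : realType) (n : nat) (p1 : 'I_n.+1 -> R)
    (q : nat -> 'I_n.+1 -> R) (k : nat) : R :=
  min_ratio (p_seq p1 q k) (q k).

(* Main.v *)
Require Import Defs.
From HB Require Import structures.
From mathcomp Require Import all_boot all_order all_algebra.
From mathcomp Require Import all_classical all_reals ereal convex.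
From mathcomp Require Import interval_inference ring.

(** Each term [m_k * J(f, x_k, q_k)] is exactly what one step of the recursion
    takes away from the Jensen functional. Passing from [(p_k, x_k)] to
    [(p_{k+1}, x_{k+1})] removes the mass [m_k * q_k], spread over the points
    [x_k], and puts the same total mass [m_k] back at their barycentre. Hence
    for every function [g] the sum of [p_i * g (x_i)] changes by [m_k] times
    [g (sum of q_i * x_i) - sum of q_i * g (x_i)] ([sum_next]). For [g] the
    identity the change is zero, so the mean is unchanged; for [g = f] it is
    [- m_k * J(f, x_k, q_k)]. Together these give [jensen_functional_next].

    Telescoping ([jensen_functional_seq]), the left-hand side of the theorem
    equals the Jensen functional of [f] at the tuples reached after [N] steps.
    The weights stay nonnegative because [m_k] is the minimal ratio, their sum
    stays 1 (take [g = 1]), and the points stay in the interval because only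
    barycentres are added ([seq_invariant]). So Jensen's inequality applies to
    the last tuples ([jensen_functional_ge0]). *)

Set Implicit Arguments.
Unset Strict Implicit.
Unset Printing Implicit Defensive.

Import Order.TTheory GRing.Theory Num.Theory.

Local Open Scope classical_set_scope.
Local Open Scope ring_scope.

(** * Finite convex combinations *)

(** Leaving the total weight [\sum w i] unnormalised keeps divisions out of the
    induction over [r]: the only quotient appears when one more point is mixed
    with the barycentre [y] already obtained, and a vanishing total weight is
    absorbed by the arbitrary member [x0] of [A]. *)
Lemma convex_set_weighted_sum (R : numFieldType) (E : lmodType R)
    (A : set (convex_lmodType E)) (x0 : E) (I : Type) (r : seq I)
    (w : I -> R) (x : I -> E) :
  convex_set A -> x0 \in A -> (forall i, 0 <= w i) -> (forall i, x i \in A) ->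
  exists2 y : E, y \in A & \sum_(i <- r) w i *: x i = (\sum_(i <- r) w i) *: y.
Proof.
move=> cA x0A w0 xA; elim: r => [|i r [y yA IH]].
  by exists x0 => //; rewrite !big_nil scale0r.
rewrite !big_cons IH.
have W0 : 0 <= \sum_(j <- r) w j by exact: sumr_ge0.
set W := \sum_(j <- r) w j in W0 *.
have [wW0|wW_neq0] := eqVneq (w i + W) 0.
  exists y => //.
  have /andP[/eqP -> /eqP ->] : (w i == 0) && (W == 0).
    by rewrite -paddr_eq0 // wW0.
  by rewrite !scale0r !addr0 scale0r.
have wW_gt0 : 0 < w i + W by rewrite lt_neqAle eq_sym wW_neq0 addr_ge0.
have t0 : 0 <= w i / (w i + W) by rewrite divr_ge0 // ltW.
have t1 : w i / (w i + W) <= 1 by rewrite ler_pdivrMr // mul1r lerDl.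
pose t := Itv01 t0 t1.
exists (conv t (x i : convex_lmodType E) (y : convex_lmodType E)).
  exact: cA.
rewrite [conv _ _ _]/(_ *: x i + (1 - w i / (w i + W)) *: y) /=.
rewrite scalerDr !scalerA mulrBr mulr1 mulrCA divff // mulr1.
by rewrite addrAC subrr add0r.
Qed.

Lemma convex_set_sum (R : numFieldType) (E : lmodType R)
    (A : set (convex_lmodType E)) (n : nat) (w : 'I_n.+1 -> R)
    (x : 'I_n.+1 -> E) :
  convex_set A -> (forall i, 0 <= w i) -> \sum_i w i = 1 ->
  (forall i, x i \in A) -> \sum_i w i *: x i \in A.
Proof.
move=> cA w0 w1 xA.
have [y yA ->] :=
  convex_set_weighted_sum (index_enum _) cA (xA ord0) w0 xA.
by rewrite w1 scale1r.
Qed.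

Definition epigraph (R : numFieldType) (E : lmodType R)
    (D : set (convex_lmodType E)) (f : convex_lmodType E -> R^o) :
    set (convex_lmodType (E * R^o)%type) :=
  [set z : E * R^o | (z.1 \in D) /\ f z.1 <= z.2].

Lemma convex_epigraph (R : numFieldType) (E : lmodType R)
    (D : set (convex_lmodType E)) (f : convex_lmodType E -> R^o) :
  convex_set D -> convex_function D f -> convex_set (epigraph D f).
Proof.
move=> cD cf z1 z2 t; rewrite !inE => -[z1D z1f] [z2D z2f].
split; first exact: (cD z1.1 z2.1 t).
apply: (le_trans (cf t z1.1 z2.1 z1D z2D)).
rewrite -[leRHS]/(t%:num * z1.2 + (1 - t%:num) * z2.2) convRE.
by apply: lerD; apply: ler_wpM2l; rewrite // subr_ge0.
Qed.

(** Jensen's inequality is the convexity of the epigraph, applied to the points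
    [(x i, f (x i))] of the graph. *)
Lemma convex_function_sum (R : numFieldType) (E : lmodType R)
    (D : set (convex_lmodType E)) (f : convex_lmodType E -> R^o) (n : nat)
    (w : 'I_n.+1 -> R) (x : 'I_n.+1 -> E) :
  convex_set D -> convex_function D f ->
  (forall i, 0 <= w i) -> \sum_i w i = 1 -> (forall i, x i \in D) ->
  f (\sum_i w i *: x i) <= \sum_i w i * f (x i).
Proof.
move=> cD cf w0 w1 xD.
have := @convex_set_sum R (E * R^o)%type (epigraph D f) n w
  (fun i => (x i, f (x i))) (convex_epigraph cD cf) w0 w1.
have -> : \sum_i w i *: ((x i, f (x i)) : E * R^o) =
    (\sum_i w i *: x i, \sum_i w i * f (x i)).
  apply: (@injective_projections E R^o); rewrite /=.
    by rewrite (raddf_sum (@fst E R^o)).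
  by rewrite (raddf_sum (@snd E R^o)).
move=> in_epi; suff : (\sum_i w i *: x i, \sum_i w i * f (x i)) \in epigraph D f.
  by rewrite inE => -[].
by apply: in_epi => i; rewrite inE; split => //=.
Qed.

Lemma convex_itv_co_ereal (R : realType) (a : R) (b : \bar R) :
  @convex_set R R^o (itv_co_ereal a b).
Proof.
move=> x y t; rewrite !inE => -[ax xb] [ay yb].
(* Betweenness is only available for endpoints given in increasing order. *)
wlog xy : x y t ax xb ay yb / x <= y.
  move=> H; have [xy|/ltW yx] := leP x y; first exact: H.
  by rewrite convC; exact: H.
have := convR_itv t xy; rewrite in_itv /= => /andP[xz zy].
split; first exact: le_trans xz.
by apply: le_lt_trans yb; rewrite lee_fin.
Qed.

Lemma jensen_functional_ge0 (R : realType) (n : nat) (D : set R) (f : R -> R)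
    (x p : 'I_n.+1 -> R) :
  @convex_set R R^o D -> @convex_function R R^o D f ->
  (forall i, 0 <= p i) -> \sum_i p i = 1 -> (forall i, x i \in D) ->
  0 <= jensen_functional f x p.
Proof.
by move=> cD cf p0 p1 xD; rewrite subr_ge0; exact: (convex_function_sum cD cf).
Qed.

(** * One step of the recursion *)

Section step.
Variables (R : realType) (n : nat) (p q : 'I_n.+1 -> R).
Hypothesis q_gt0 : forall i, 0 < q i.

Lemma min_ratio_attained : exists i, p i / q i = min_ratio p q.
Proof.
apply: (big_rec (fun m => exists i, p i / q i = m)); first by exists ord0.
by move=> i m _ [j jm]; case: (leP (p i / q i) m) => _; [exists i|exists j].
Qed.

Lemma min_ratio_mult_neq0 : (min_ratio_mult p q)%:R != 0 :> R.
Proof.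
rewrite pnatr_eq0 -lt0n card_gt0; apply/set0Pn.
by have [i ip] := min_ratio_attained; exists i; rewrite inE; apply/eqP.
Qed.

Lemma min_ratio_ge0 : (forall i, 0 <= p i) -> 0 <= min_ratio p q.
Proof.
by move=> p0; have [i <-] := min_ratio_attained; rewrite divr_ge0 // ltW.
Qed.

Lemma min_ratio_mul_le i : min_ratio p q * q i <= p i.
Proof. by rewrite -ler_pdivlMr //; exact: bigmin_le. Qed.

(** At an index attaining the minimum, [p i - m * q i] vanishes, so the [s]
    shares [m / s] of the weight [m] placed there can be added to the uniform
    expression [p i - m * q i] over all indices. *)
Lemma sum_next (x g : _ -> R) :
  \sum_i next_p p q i * g (next_x p q x i) =
  \sum_i p i * g (x i) - min_ratio p q * \sum_i q i * g (x i)
  + min_ratio p q * g (\sum_l q l * x l).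
Proof.
set m := min_ratio p q; set xq := \sum_l q l * x l.
have termE i : next_p p q i * g (next_x p q x i) =
    (p i - m * q i) * g (x i)
    + (if p i / q i == m then (min_ratio_mult p q)%:R^-1 * m * g xq else 0).
  rewrite /next_p /next_x -/m -/xq; case: eqP => [pq|_]; last by rewrite addr0.
  by rewrite -[p i](divfK (lt0r_neq0 (q_gt0 i))) pq subrr mul0r add0r.
rewrite (eq_bigr _ (fun i _ => termE i)) big_split /=; congr (_ + _).
  rewrite mulr_sumr -sumrB; apply: eq_bigr => i _; ring.
rewrite -big_mkcond /= sumr_const -cardsE -/(min_ratio_mult p q).
by rewrite -[LHS]mulr_natl !mulrA divff ?mul1r ?min_ratio_mult_neq0.
Qed.

Lemma next_p_ge0 : (forall i, 0 <= p i) -> forall i, 0 <= next_p p q i.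
Proof.
move=> p0 i; rewrite /next_p; case: ifP => _.
  by rewrite mulr_ge0 ?invr_ge0 ?ler0n ?min_ratio_ge0.
by rewrite subr_ge0 min_ratio_mul_le.
Qed.

Hypothesis q_sum : \sum_i q i = 1.

Lemma sum_next_p : \sum_i next_p p q i = \sum_i p i.
Proof.
have := sum_next (fun=> 0) (fun=> 1).
have sum1 (w : 'I_n.+1 -> R) : \sum_i w i * 1 = \sum_i w i.
  by apply: eq_bigr => i _; rewrite mulr1.
by rewrite !sum1 q_sum subrK.
Qed.

Lemma next_x_in (D : set R) (x : 'I_n.+1 -> R) :
  @convex_set R R^o D ->
  (forall i, x i \in D) -> forall i, next_x p q x i \in D.
Proof.
move=> cD xD i; rewrite /next_x; case: ifP => // _.
by apply: (convex_set_sum cD) => // j; rewrite ltW.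
Qed.

(** The step replaces the mass [m * q] spread over the points [x] by the same
    mass at their barycentre. The mean is preserved, while the sum of the
    values of [f] loses exactly [m] times the Jensen functional at [q]. *)
Lemma jensen_functional_next (f : R -> R) (x : 'I_n.+1 -> R) :
  jensen_functional f (next_x p q x) (next_p p q) =
  jensen_functional f x p - min_ratio p q * jensen_functional f x q.
Proof.
rewrite /jensen_functional (sum_next x f) (sum_next x id) subrK; ring.
Qed.

End step.

(** * The iterated refinement *)

Lemma jensen_functional_seq (R : realType) (n N : nat)
    (p1 x1 : 'I_n.+1 -> R) (q : nat -> 'I_n.+1 -> R) (f : R -> R) :
  (forall k, (k < N)%N -> forall i, 0 < q k i) ->
  jensen_functional f x1 p1
    - \sum_(k < N) m_seq p1 q k * jensen_functional f (x_seq p1 x1 q k) (q k)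
  = jensen_functional f (x_seq p1 x1 q N) (p_seq p1 q N).
Proof.
elim: N => [|N IH] hq; first by rewrite big_ord0 subr0.
rewrite big_ord_recr /= jensen_functional_next; last exact: hq.
by rewrite -IH ?opprD ?addrA // => k kN; apply: hq; exact: ltnW.
Qed.

Lemma seq_invariant (R : realType) (n N : nat) (D : set R)
    (p1 x1 : 'I_n.+1 -> R) (q : nat -> 'I_n.+1 -> R) :
  @convex_set R R^o D ->
  (forall k, (k < N)%N -> forall i, 0 < q k i) ->
  (forall k, (k < N)%N -> \sum_i q k i = 1) ->
  (forall i, 0 <= p1 i) -> \sum_i p1 i = 1 -> (forall i, x1 i \in D) ->
  [/\ forall i, 0 <= p_seq p1 q N i, \sum_i p_seq p1 q N i = 1
    & forall i, x_seq p1 x1 q N i \in D].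
Proof.
move=> cD + + p0 ps xD; elim: N => [//|N IH] hq hqs.
have [|k kN|p0N psN xDN] := IH _ _.
- by move=> k kN; apply: hq; exact: ltnW.
- by apply: hqs; exact: ltnW.
have qN := hq N (ltnSn N); have qsN := hqs N (ltnSn N); split => /=.
- exact: next_p_ge0.
- by rewrite sum_next_p.
- exact: next_x_in.
Qed.

Theorem theorem6 (R : realType) (a : R) (b : \bar R) (hab : (a%:E < b)%E)
  (f : R -> R) (hf : @convex_function R R^o (itv_co_ereal a b) f)
  (n N : nat) (hN : (1 <= N)%N)
  (p1 : 'I_n.+1 -> R) (hp1 : forall i, 0 <= p1 i) (hp1_sum : \sum_i p1 i = 1)
  (q : nat -> 'I_n.+1 -> R)
  (hq : forall k, (k < N)%N -> forall i, 0 < q k i)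
  (hq_sum : forall k, (k < N)%N -> \sum_i q k i = 1)
  (x1 : 'I_n.+1 -> R) (hx1 : forall i, a < x1 i /\ ((x1 i)%:E < b)%E) :
  jensen_functional f x1 p1
    - \sum_(k < N) m_seq p1 q k * jensen_functional f (x_seq p1 x1 q k) (q k)
  >= 0.
Proof.
have cD := @convex_itv_co_ereal R a b.
have xD i : x1 i \in itv_co_ereal a b.
  by rewrite inE; have [/ltW ax xb] := hx1 i; split.
have [p0 ps xN] := seq_invariant cD hq hq_sum hp1 hp1_sum xD.
rewrite jensen_functional_seq //.
exact: (jensen_functional_ge0 cD hf).
Qed.
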